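(* Let $n\ge 3$, let $(\mathfrak g,[\cdot,\cdot],\alpha)$ be a multiplicative Hom-Lie algebra over $\mathbb K$, and let $\phi\in\wedge^{n-2}\mathfrak g^*$ satisfy $\phi\wedge\delta\phi_X=0$ for all $X\in\wedge^{n-3}\mathfrak g$ and $\phi\circ(\alpha\otimes\mathrm{Id}\otimes\cdots\otimes\mathrm{Id})=\phi$; let $(\mathfrak g,[\cdot,\dots,\cdot]_\phi,\alpha)$ be the induced $n$-Hom-Lie algebra. Let $k\ge -1$ and let $D:\mathfrak g\to\mathfrak g$ be an $\alpha^k$-derivation of $(\mathfrak g,[\cdot,\cdot],\alpha)$ such that $$\sum_{i=1}^{n-2}\phi(x_1,\dots,D(x_i),\dots,x_{n-2})=0\qquad\text{for all }x_1,\dots,x_{n-2}\in\mathfrak g.$$ Then $D$ is an $\alpha^k$-derivation of $(\mathfrak g,[\cdot,\dots,\cdot]_\phi,\alpha)$.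
   Context: $\mathbb K$ is an algebraically closed field of characteristic zero. A hat denotes omission of an argument. A Hom-Lie algebra is a triple $(\mathfrak g,[\cdot,\cdot],\alpha)$ with $[\cdot,\cdot]:\mathfrak g\times\mathfrak g\to\mathfrak g$ bilinear, $\alpha:\mathfrak g\to\mathfrak g$ linear, such that $[x,y]=-[y,x]$ and $[\alpha(x),[y,z]]+[\alpha(y),[z,x]]+[\alpha(z),[x,y]]=0$. It is multiplicative if $\alpha([x,y])=[\alpha(x),\alpha(y)]$. $\wedge^{n-2}\mathfrak g^*$ is the space of skew-symmetric $(n-2)$-linear forms on $\mathfrak g$. For $X=(x_1,\dots,x_{n-3})$, $\phi_X(z)=\phi(x_1,\dots,x_{n-3},z)$, and for $y_1,\dots,y_n\in\mathfrak g$, $$(\phi\wedge\delta\phi_X)(y_1,\dots,y_n)=\sum_{i<j}(-1)^{i+j}\phi(y_1,\dots,\widehat{y_i},\dots,\widehat{y_j},\dots,y_n)\,\phi_X([y_i,y_j]).$$ The $n$-ary product is $$[x_1,\dots,x_n]_\phi=\sum_{i<j}(-1)^{i+j+1}\phi(x_1,\dots,\widehat{x_i},\dots,\widehat{x_j},\dots,x_n)\,[x_i,x_j].$$ $\alpha^k$ is the $k$-fold composition of $\alpha$, with the conventions $\alpha^0=\mathrm{id}$ and $\alpha^{-1}=0$. For a vector space $\mathcal N$ with an $m$-linear bracket ($m\geq2$) and a linear map $\alpha$, a linear map $D:\mathcal N\to\mathcal N$ is an $\alpha^k$-derivation if $D\circ\alpha=\alpha\circ D$ and $$D([x_1,\dots,x_m])=\sum_{i=1}^m[\alpha^k(x_1),\dots,\alpha^k(x_{i-1}),D(x_i),\alpha^k(x_{i+1}),\dots,\alpha^k(x_m)]$$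 for all $x_1,\dots,x_m\in\mathcal N$; this is used with $m=2$ for the Hom-Lie bracket and with $m=n$ for $[\cdot,\dots,\cdot]_\phi$. *)

(* Defs.v *)
From mathcomp Require Import all_boot all_order all_fingroup all_algebra.
Set Implicit Arguments.
Unset Strict Implicit.
Unset Printing Implicit Defensive.
Import Order.TTheory GRing.Theory Num.Theory.
Local Open Scope ring_scope.

(* Indices are 0-based ('I_n = {0, ..., n - 1}), so an argument written y_i
   with 1 <= i <= n is [y (i - 1)] here. The shift does not change the parity
   of i + j, hence the signs (-1)^(i+j) keep their form.

   Argument tuples are finite functions {ffun 'I_m -> g}, and m-ary maps are
   plain functions on them. *)

Fact omit2_subproof (n : nat) (i j : 'I_n) (k : 'I_(n - 2)) :
  (bump j (bump i k) < n)%N.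
Proof.
have lek : (bump j (bump i k) <= k.+2)%N.
  by rewrite /bump -(add1n k.+1) -(add1n k) !leq_add ?leq_b1.
by apply: leq_ltn_trans lek _; have := ltn_ord k; rewrite ltn_subRL.
Qed.

(* For i < j: the index in 'I_n of the k-th entry of the list 0, ..., n - 1
   from which j, and then i, have been removed. Only used with i < j. *)
Definition omit2 (n : nat) (i j : 'I_n) (k : 'I_(n - 2)) : 'I_n :=
  Ordinal (omit2_subproof i j k).

Section Tuples.
Variable g : Type.

Definition set_arg (m : nat) (x : {ffun 'I_m -> g}) (i : 'I_m) (z : g) :
    {ffun 'I_m -> g} :=
  [ffun j => if j == i then z else x j].

(* (y_1, ..., hat y_i, ..., hat y_j, ..., y_n), for i < j *)
Definition omit_args (n : nat) (i j : 'I_n) (y : {ffun 'I_n -> g}) :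
    {ffun 'I_(n - 2) -> g} :=
  [ffun k => y (omit2 i j k)].

(* (x_1, ..., x_(n-3), z), for n >= 3 *)
Definition append_arg (n : nat) (X : {ffun 'I_(n - 3) -> g}) (z : g) :
    {ffun 'I_(n - 2) -> g} :=
  [ffun k : 'I_(n - 2) => oapp X z (insub (val k))].

(* A binary bracket as an m-ary one with m = 2. *)
Definition bracket2 (br : g -> g -> g) (x : {ffun 'I_2 -> g}) : g :=
  br (x ord0) (x ord_max).

End Tuples.

Section HomLie.
Variables (K : fieldType) (g : lmodType K).

Definition hom_lie (br : {bilinear g -> g -> g}) (alpha : {linear g -> g}) :
    Prop :=
  (forall x y, br x y = - br y x) /\
  (forall x y z, br (alpha x) (br y z) + br (alpha y) (br z x)
                 + br (alpha z) (br x y) = 0).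

Definition multiplicative_hom_lie (br : {bilinear g -> g -> g})
    (alpha : {linear g -> g}) : Prop :=
  hom_lie br alpha /\ (forall x y, alpha (br x y) = br (alpha x) (alpha y)).

Definition multilinear_form (m : nat) (phi : {ffun 'I_m -> g} -> K) : Prop :=
  forall (x : {ffun 'I_m -> g}) (i : 'I_m) (a : K) (u v : g),
    phi (set_arg x i (a *: u + v))
    = a * phi (set_arg x i u) + phi (set_arg x i v).

Definition skew_symmetric_form (m : nat) (phi : {ffun 'I_m -> g} -> K) :
    Prop :=
  forall (x : {ffun 'I_m -> g}) (i j : 'I_m), i != j ->
    phi [ffun k => x (tperm i j k)] = - phi x.

(* phi \in \wedge^m g^* *)
Definition skew_multilinear_form (m : nat) (phi : {ffun 'I_m -> g} -> K) :
    Prop :=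
  multilinear_form phi /\ skew_symmetric_form phi.

(* (phi \wedge \delta phi_X)(y_1, ..., y_n) *)
Definition wedge_delta (n : nat) (br : g -> g -> g)
    (phi : {ffun 'I_(n - 2) -> g} -> K) (X : {ffun 'I_(n - 3) -> g})
    (y : {ffun 'I_n -> g}) : K :=
  \sum_(i < n) \sum_(j < n | (i < j)%N)
    (-1) ^+ (i + j) * phi (omit_args i j y)
                    * phi (append_arg X (br (y i) (y j))).

(* [x_1, ..., x_n]_phi *)
Definition induced_bracket (n : nat) (br : g -> g -> g)
    (phi : {ffun 'I_(n - 2) -> g} -> K) (x : {ffun 'I_n -> g}) : g :=
  \sum_(i < n) \sum_(j < n | (i < j)%N)
    ((-1) ^+ (i + j + 1) * phi (omit_args i j x)) *: br (x i) (x j).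

(* phi \o (alpha \otimes Id \otimes ... \otimes Id) = phi *)
Definition alpha_invariant (m : nat) (alpha : g -> g)
    (phi : {ffun 'I_m -> g} -> K) : Prop :=
  forall x : {ffun 'I_m -> g},
    phi [ffun k : 'I_m => if val k == 0%N then alpha (x k) else x k] = phi x.

(* alpha^k, with alpha^(-1) = 0; values at k < -1 are irrelevant. *)
Definition alpha_pow (alpha : g -> g) (k : int) (x : g) : g :=
  match k with
  | Posz p => iter p alpha x
  | Negz _ => 0
  end.

Definition alpha_derivation (m : nat) (br : {ffun 'I_m -> g} -> g)
    (alpha : g -> g) (k : int) (D : {linear g -> g}) : Prop :=
  (forall x, D (alpha x) = alpha (D x)) /\
  (forall x : {ffun 'I_m -> g},
     D (br x) = \sum_(i < m)
       br (set_arg [ffun j => alpha_pow alpha k (x j)] i (D (x i)))).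

End HomLie.

(* Main.v *)
(* Expanding the sum of the induced brackets containing one D(x_l) gives terms
   of two kinds. When D hits one of the two bracketed arguments, alpha^k can be
   dropped inside phi (invariance in the first slot spreads to every slot by
   skew-symmetry) and the pieces reassemble into phi(...) D [x_i, x_j]. When D
   hits an argument of phi, alpha^k can be dropped again and the sum over the
   slots of phi vanishes by hypothesis. For k = -1 both sides are zero. *)
Require Import Defs.
From mathcomp Require Import all_boot all_order all_fingroup all_algebra.
Set Implicit Arguments.
Unset Strict Implicit.
Unset Printing Implicit Defensive.
Import Order.TTheory GRing.Theory Num.Theory.
Local Open Scope ring_scope.

Lemma omit2_inj (n : nat) (i j : 'I_n) : injective (omit2 i j).
Proof.
by move=> k l /(congr1 val) /(can_inj (bumpK _)) /(can_inj (bumpK _)) /val_inj.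
Qed.

Lemma omit2_neqr (n : nat) (i j : 'I_n) k : (omit2 i j k == j) = false.
Proof. by rewrite -val_eqE /= eq_sym; apply/negbTE/neq_bump. Qed.

Lemma omit2_neql (n : nat) (i j : 'I_n) k :
  (i < j)%N -> (omit2 i j k == i) = false.
Proof.
move=> ltij; have bumpi : bump j i = i by rewrite /bump leqNgt ltij.
rewrite -val_eqE /= -[X in _ == X]bumpi (inj_eq (can_inj (bumpK j))) eq_sym.
by apply/negbTE/neq_bump.
Qed.

(** Since i < j, removing j does not renumber i, so two uses of [lift] take out j and then i and
    list the remaining indices exactly as [omit2] does. *)
Lemma sum_omit2 (V : nmodType) (n : nat) (i j : 'I_n) (F : 'I_n -> V) :
  (i < j)%N ->
  \sum_l F l = F j + (F i + \sum_(k < n - 2) F (omit2 i j k)).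
Proof.
case: n i j F => [|[|n]] i j F ltij; first by case: i ltij.
  by move: ltij; rewrite !ord1.
have lti : (i < n.+1)%N by rewrite -ltnS (leq_ltn_trans ltij).
have Ei : lift j (Ordinal lti) = i.
  by apply: val_inj; rewrite /= /bump leqNgt ltij.
rewrite (bigD1_ord j) // (bigD1_ord (Ordinal lti)) //= Ei.
congr (_ + (_ + _)).
(* [n.+2 - 2] reduces to [n - 0], which is convertible to [n] only once [n] is destructed. *)
by case: n i j F ltij lti Ei => [|n] i j F _ lti _; apply: eq_bigr => k _;
  congr F; apply: val_inj.
Qed.

Section OmitArgs.
Variables (g : Type) (n : nat) (i j : 'I_n) (y : {ffun 'I_n -> g}) (z : g).

Lemma omit_args_setl : (i < j)%N ->
  omit_args i j (set_arg y i z) = omit_args i j y.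
Proof. by move=> ltij; apply/ffunP => k; rewrite !ffunE omit2_neql. Qed.

Lemma omit_args_setr : omit_args i j (set_arg y j z) = omit_args i j y.
Proof. by apply/ffunP => k; rewrite !ffunE omit2_neqr. Qed.

Lemma omit_args_set k :
  omit_args i j (set_arg y (omit2 i j k) z) = set_arg (omit_args i j y) k z.
Proof. by apply/ffunP => l; rewrite !ffunE (inj_eq (@omit2_inj _ _ _)). Qed.

End OmitArgs.

Section AlphaInvariant.
Variables (K : fieldType) (g : lmodType K) (m : nat) (alpha : g -> g).
Variable phi : {ffun 'I_m -> g} -> K.
Hypothesis phi_skew : skew_symmetric_form phi.
Hypothesis phi_inv : alpha_invariant alpha phi.

(** Transpose slot i with slot 0, apply invariance there and transpose back: the two signs
    cancel. *)
Lemma alpha_invariant_set x i : phi (set_arg x i (alpha (x i))) = phi x.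
Proof.
have m_gt0 : (0 < m)%N := leq_ltn_trans (leq0n i) (ltn_ord i).
pose o := Ordinal m_gt0.
have [->|neq_io] := eqVneq i o.
  rewrite -[RHS]phi_inv; congr phi; apply/ffunP => k; rewrite !ffunE -val_eqE /=.
  by case: eqP => // /(@ord_inj _ k o) ->.
pose xt := [ffun k => x (tperm i o k)].
have -> : set_arg x i (alpha (x i)) =
    [ffun k => [ffun l : 'I_m => if val l == 0%N then alpha (xt l) else xt l]
                 (tperm i o k)].
  apply/ffunP => k; rewrite !ffunE tpermK.
  have -> : (val (tperm i o k) == 0%N) = (k == i).
    by rewrite -(inj_eq (@perm_inj _ (tperm i o))) tpermL.
  by case: eqP => // ->.
by rewrite phi_skew // phi_inv phi_skew // opprK.
Qed.

Lemma alpha_invariant_set_iter x i p :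
  phi (set_arg x i (iter p alpha (x i))) = phi x.
Proof.
elim: p => [|p IHp] /=.
  by congr phi; apply/ffunP => k; rewrite ffunE; case: eqP => // ->.
rewrite -[RHS]IHp -(alpha_invariant_set (set_arg x i (iter p alpha (x i))) i).
by congr phi; apply/ffunP => k; rewrite !ffunE eqxx; case: eqP.
Qed.

(** The exponent may vary with the slot, so that exponent 0 can leave a chosen slot untouched. *)
Lemma alpha_invariant_iter (x : {ffun 'I_m -> g}) (c : 'I_m -> nat) :
  phi [ffun j => iter (c j) alpha (x j)] = phi x.
Proof.
(* Interpolate between the two tuples, changing one slot at a time. *)
pose y t := [ffun j : 'I_m => if (j < t)%N then iter (c j) alpha (x j) else x j].
suff Hy t : (t <= m)%N -> phi (y t) = phi x.
  by rewrite -(Hy m) //; congr phi; apply/ffunP => j; rewrite !ffunE ltn_ord.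
elim: t => [_|t IHt lt_tm].
  by congr phi; apply/ffunP => j; rewrite ffunE.
pose i := Ordinal lt_tm.
rewrite -(IHt (ltnW lt_tm)) -(alpha_invariant_set_iter (y t) i (c i)).
congr phi; apply/ffunP => j; rewrite !ffunE /= ltnn ltnS leq_eqVlt -val_eqE /=.
by case: eqP => //= /(@ord_inj _ j i) ->.
Qed.

Lemma alpha_invariant_set_pow (x : {ffun 'I_m -> g}) i z p :
  phi (set_arg [ffun j => iter p alpha (x j)] i z) = phi (set_arg x i z).
Proof.
(* Exponent 0 at slot i protects the inserted [z], which need not be an iterate of [alpha]. *)
rewrite -[RHS](alpha_invariant_iter _ (fun j => if j == i then 0%N else p)).
by congr phi; apply/ffunP => j; rewrite !ffunE; case: eqP.
Qed.

End AlphaInvariant.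

Lemma alpha_derivation_bracket2 (K : fieldType) (g : lmodType K)
  (br : g -> g -> g) (alpha : g -> g) (k : int) (D : {linear g -> g}) x y :
  alpha_derivation (bracket2 br) alpha k D ->
  D (br x y) = br (D x) (alpha_pow alpha k y) + br (alpha_pow alpha k x) (D y).
Proof.
case=> _ /(_ [ffun i => if i == ord0 then x else y]).
by rewrite big_ord_recl big_ord1 /bracket2 !ffunE.
Qed.

Theorem proposition2p6 (K : closedFieldType) (charK0 : [pchar K] =i pred0)
  (n : nat) (n_ge3 : (3 <= n)%N)
  (g : lmodType K) (br : {bilinear g -> g -> g}) (alpha : {linear g -> g})
  (hg : multiplicative_hom_lie br alpha)
  (phi : {ffun 'I_(n - 2) -> g} -> K)
  (hphi : skew_multilinear_form phi)
  (hwedge : forall (X : {ffun 'I_(n - 3) -> g}) (y : {ffun 'I_n -> g}),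
     wedge_delta br phi X y = 0)
  (halpha : alpha_invariant alpha phi)
  (k : int) (k_ge : -1 <= k)
  (D : {linear g -> g})
  (hD : alpha_derivation (bracket2 br) alpha k D)
  (hDphi : forall x : {ffun 'I_(n - 2) -> g},
     \sum_(i < n - 2) phi (set_arg x i (D (x i))) = 0) :
  alpha_derivation (induced_bracket br phi) alpha k D.
Proof.
split=> [|x]; first by case: hD.
pose y := [ffun j => alpha_pow alpha k (x j)].
(* Moving the sum over the slot of [D] innermost reduces the claim to an identity for each pair i <
   j. *)
rewrite -/y /induced_bracket exchange_big linear_sum /=.
apply: eq_bigr => i _; rewrite exchange_big linear_sum /=.
apply: eq_bigr => j ltij.
have neq_ji : (j == i) = false by rewrite -val_eqE gtn_eqF.
rewrite linearZ /= (alpha_derivation_bracket2 _ _ hD) (sum_omit2 _ ltij).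
rewrite omit_args_setr omit_args_setl // !ffunE !eqxx neq_ji eq_sym neq_ji.
under eq_bigr => l _.
  rewrite omit_args_set !ffunE ![_ == omit2 _ _ _]eq_sym omit2_neql // omit2_neqr.
  over.
case: k k_ge hD @y => [p|p] _ hD y /=; last first.
  (* Here [alpha_pow] is 0, and every bracket has at least one argument without [D], so all of them
     vanish. *)
  rewrite !linear0l !linear0r !addr0 !scaler0 !add0r.
  by rewrite big1 // => l _; rewrite scaler0.
have yE : omit_args i j y = [ffun l => iter p alpha (omit_args i j x l)].
  by apply/ffunP => l; rewrite !ffunE.
(* When [D] falls inside [phi], the sign and the bracket do not depend on l and factor out. What
   remains is the sum in [hDphi] for the tuple [omit_args i j x]. *)
rewrite -scaler_suml -mulr_sumr yE alpha_invariant_iter //; last by case: hphi.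
under eq_bigr => l _.
  rewrite alpha_invariant_set_pow //; last by case: hphi.
  rewrite (_ : x _ = omit_args i j x l); last by rewrite ffunE.
  over.
by rewrite hDphi mulr0 scale0r addr0 scalerDr addrC.
Qed.
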